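(* Let $z$ be a prior finite measure on $(E,\mathcal{F}_E)$ and let $k:E\times E\to\mathbb{R}$ be a kernel with $\sup_{x\in E}k(x,x)=c<\infty$, such that the kernel sum rule applies for a fixed time lag $\eta\in\mathbb{N}_{>0}$; that is, $\mu_z\in\operatorname{dom}(C(0)^\dagger)$ and, with $U_\eta:=C(\eta)C(0)^\dagger$, $$\langle f,U_\eta\mu_z\rangle_{\mathscr{H}}=\int_E\mathbb{E}[f(X_{t+\eta})\mid X_t=x]\,dz(x)\qquad\text{for all }f\in\mathscr{H}.$$ Then the empirical estimate $U_\eta^{(\gamma,n)}\widehat{\mu}_z$ admits the total error bound $$\|U_\eta^{(\gamma,n)}\widehat{\mu}_z-U_\eta\mu_z\|_{\mathscr{H}}\le e_s(\mu_z,\widehat{\mu}_z,n,\gamma)+e_r(\mu_z,\gamma)\quad\mathbb{P}\text{-a.e.}$$ with the stochastic estimation error $$e_s(\mu_z,\widehat{\mu}_z,n,\gamma):=\frac{c}{\gamma}\|\widehat{\mu}_z-\mu_z\|_{\mathscr{H}}+\frac{c^{3/2}}{\gamma^2}\|C_n(0)-C(0)\|+\frac{c^{1/2}}{\gamma}\|C_n(\eta)-C(\eta)\|$$ and the deterministic regularization error $$e_r(\mu_z,\gamma):=c\,\big\|(C(0)+\gamma\mathcal{I}_{\mathscr{H}})^{-1}\mu_z-C(0)^\dagger\mu_z\big\|_{\mathscr{H}}.$$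
   Context: Setting and standing assumptions: $(\Omega,\mathcal{F},\mathbb{P})$ is a probability space, $E$ is a Polish space with Borel $\sigma$-field $\mathcal{F}_E$, and $(X_t)_{t\in\mathbb{Z}}$ is a stationary $E$-valued process: all finite-dimensional laws are invariant under time shifts. $\mathscr{H}$ is a separable real reproducing kernel Hilbert space of functions $E\to\mathbb{R}$ with kernel $k$ and canonical feature map $\varphi(x)=k(x,\cdot)$, assumed Borel measurable $E\to\mathscr{H}$; $\varphi(X_0)$ is Bochner square-integrable, and the embedded process is centered, $\mathbb{E}[\varphi(X_0)]=0$. Notation: for $u,v\in\mathscr{H}$, $u\otimes v$ is the rank-one operator $h\mapsto\langle h,v\rangle_{\mathscr{H}}\,u$. $C(\eta)=\mathbb{E}[\varphi(X_\eta)\otimes\varphi(X_0)]$ and $C_n(\eta)=\frac1n\sum_{t=1}^n\varphi(X_{t+\eta})\otimes\varphi(X_t)$ (also for $\eta=0$), where $n\ge1$ is the sample size. $\|\cdot\|$ is the operator norm, $\mathcal{I}_{\mathscr{H}}$ the identity on $\mathscr{H}$, and $\gamma>0$ a regularization parameter. $C(0)^\dagger:\operatorname{range}(C(0))\oplus\operatorname{range}(C(0))^\perp\to\mathscr{H}$ is the Moore--Penrose pseudoinverse (in general unbounded), with domain $\operatorname{dom}(C(0)^\dagger)=\operatorname{range}(C(0))\oplus\operatorname{range}(C(0))^\perp$. The prior $z$ satisfies $\int_E\|\varphi(x)\|_{\mathscr{H}}\,dz(x)<\infty$, its kernel mean embedding is $\mu_z=\int_E\varphi(x)\,dz(x)\in\mathscr{H}$,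 and $\widehat{\mu}_z$ is an $\mathscr{H}$-valued empirical estimate of $\mu_z$. The regularized empirical conditional mean operator is $U_\eta^{(\gamma,n)}=C_n(\eta)(C_n(0)+\gamma\mathcal{I}_{\mathscr{H}})^{-1}$.
   Formalization: The prior finite measure z is additionally assumed to have total mass z(E) ≤ 1 (e.g. a probability measure); for larger mass the stated bound fails, since it needs the norm of μ_z to be at most c^{1/2}. *)

(* Defs.v *)
From HB Require Import structures.
From mathcomp Require Import all_boot all_order all_algebra.
From mathcomp Require Import all_classical all_reals all_analysis.

Set Implicit Arguments.
Unset Strict Implicit.
Unset Printing Implicit Defensive.

Import Order.TTheory GRing.Theory Num.Theory.
Import numFieldNormedType.Exports.
Local Open Scope classical_set_scope.
Local Open Scope ring_scope.

Notation borel E := (g_sigma_algebraType (@open E)).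

Definition separable (E : topologicalType) : Prop :=
  exists2 S : set E, countable S & dense S.

Definition polish (R : realType) (E : topologicalType) : Prop :=
  separable E /\
  exists dist : E -> E -> R,
    [/\ forall x y, (dist x y = 0) <-> (x = y),
        forall x y, dist x y = dist y x,
        forall x y z, dist x z <= dist x y + dist y z,
        forall (x : E) (A : set E), nbhs x A <->
          exists2 e, 0 < e & [set y | dist x y < e] `<=` A &
        forall u : nat -> E,
          (forall e, 0 < e -> exists m, forall i j,
              (m <= i)%N -> (m <= j)%N -> dist (u i) (u j) < e) ->
          exists l : E, u @ \oo --> l].

Definition stationary (R : realType) d (T : measurableType d)
    (P : probability T R) dE (E : measurableType dE)
    (X : int -> {RV P >-> E}) : Prop :=
  forall (n : nat) (ts : n.-tuple int) (s : int) (A : set (n.-tuple E)),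
    measurable A ->
    P [set w | A [tuple X (tnth ts i + s) w | i < n]] =
    P [set w | A [tuple X (tnth ts i) w | i < n]].

(* The elements of the abstract Hilbert space H are identified with functions
   on E through the injective linear map ev. *)
Record is_rkhs (R : realType) (E : Type) (H : completeNormedModType R)
    (ip : {dot H for idfun}) (ev : H -> E -> R)
    (k : E -> E -> R) (phi : E -> H) : Prop := {
  rkhs_norm : forall h, `|h| ^+ 2 = ip h h;
  rkhs_ev_linear : linear ev;
  rkhs_ev_inj : injective ev;
  rkhs_feature : forall x, ev (phi x) = k x;
  rkhs_reproducing : forall f x, ev f x = ip f (phi x)
}.

(* The norm N is a parameter with values in \bar R so that the same definition
   covers H with its norm and the bounded operators on H inside the function
   space H -> H, where N is +oo outside the space of interest. *)
Section bochner.
Context (R : realType) d (T : measurableType d).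
Variables (mu : {measure set T -> \bar R}) (V : lmodType R) (N : V -> \bar R).

Definition bochner_simple (s : T -> V) : Prop :=
  [/\ finite_set (range s),
      forall v, measurable (s @^-1` [set v]),
      forall v, v != 0 -> (mu (s @^-1` [set v]) < +oo)%E &
      forall t, (N (s t) < +oo)%E].

Definition bochner_simple_integral (s : T -> V) : V :=
  \sum_(v \in range s) fine (mu (s @^-1` [set v])) *: v.

Definition is_bochner_integral (f : T -> V) (v : V) : Prop :=
  exists s : nat -> T -> V,
    [/\ forall n, bochner_simple (s n),
        {ae mu, forall t, N (f t - s n t) @[n --> \oo] --> 0%E},
        (\int[mu]_t N (f t - s n t))%E @[n --> \oo] --> 0%E &
        N (v - bochner_simple_integral (s n)) @[n --> \oo] --> 0%E].

(* 0 when f is not Bochner integrable *)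
Definition bochner_integral (f : T -> V) : V :=
  xget 0 [set v | is_bochner_integral f v].

End bochner.

Definition normE (R : realType) (H : normedModType R) (h : H) : \bar R :=
  `|h|%:E.

(* +oo unless A is linear and bounded *)
Definition opnormE (R : realType) (H : normedModType R) (A : H -> H) : \bar R :=
  ereal_inf [set M%:E | M in
    [set M : R | [/\ linear A, 0 <= M & forall h, `|A h| <= M * `|h|]]].

Definition opnorm (R : realType) (H : normedModType R) (A : H -> H) : R :=
  fine (opnormE A).

Section operators.
Context (R : realType) (H : normedModType R).
Variable ip : {dot H for idfun}.

Definition rank_one (u v : H) : H -> H := fun h => ip h v *: u.

(* (A + g I)^-1; functional inverse with junk value 0 off the range *)
Definition regularized_inverse (A : H -> H) (g : R) : H -> H :=
  'pinv_(fun=> 0) [set: H] (fun h => A h + g *: h).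

Definition orthogonal_to (S : set H) (w : H) : Prop :=
  forall v, S v -> ip w v = 0.

Definition pseudoinverse_dom (A : H -> H) : set H :=
  [set y | exists u w, orthogonal_to (range A) w /\ y = A u + w].

(* For y in the domain, the only x in (ker A)^perp such that A x is the
   component of y in range A. *)
Definition pseudoinverse (A : H -> H) (y : H) : H :=
  xget 0 [set x | orthogonal_to (range A) (y - A x) /\
                  orthogonal_to [set h | A h = 0] x].

End operators.

Section autocovariance.
Context (R : realType) d (T : measurableType d) (P : probability T R).
Context (H : normedModType R).
Variables (ip : {dot H for idfun}) (Y : int -> T -> H).

Definition autocov (eta : nat) : H -> H :=
  bochner_integral P (@opnormE R H)
    (fun w => rank_one ip (Y eta%:Z w) (Y 0 w)).

Definition emp_autocov (n eta : nat) (w : T) : H -> H :=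
  n%:R^-1 *: \sum_(1 <= t < n.+1) rank_one ip (Y (t%:Z + eta%:Z) w) (Y t%:Z w).

Definition emp_cond_mean_op (g : R) (n eta : nat) (w : T) : H -> H :=
  emp_autocov n eta w \o regularized_inverse (emp_autocov n 0 w) g.

Definition cond_mean_op (eta : nat) : H -> H :=
  autocov eta \o pseudoinverse ip (autocov 0).

End autocovariance.

(* g is a version of x |-> E[Y | X = x] *)
Definition is_cond_mean (R : realType) d (T : measurableType d)
    (P : probability T R) dE (E : measurableType dE)
    (X : {RV P >-> E}) (Y : T -> R) (g : E -> R) : Prop :=
  [/\ measurable_fun [set: E] g,
      P.-integrable [set: T] (EFin \o Y),
      P.-integrable [set: T] (fun w => (g (X w))%:E) &
      forall B : set E, measurable B ->
        (\int[P]_(w in X @^-1` B) (Y w)%:E =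
         \int[P]_(w in X @^-1` B) (g (X w))%:E)%E].

(* Main.v *)
Require Import Defs.
From HB Require Import structures.
From mathcomp Require Import all_boot all_order all_algebra.
From mathcomp Require Import all_classical all_reals all_analysis.
From mathcomp Require Import measurable_realfun.
From mathcomp Require Import ring lra.

Set Implicit Arguments.
Unset Strict Implicit.
Unset Printing Implicit Defensive.

Import Order.TTheory GRing.Theory Num.Theory.
Import numFieldNormedType.Exports.
Local Open Scope classical_set_scope.
Local Open Scope ring_scope.

(** The error splits along
      U_n mhat - U m = C_n(eta) (R_n mhat - R_n m) + C_n(eta) (R_n m - R m)
                       + (C_n(eta) - C(eta)) (R m) + C(eta) (R m - C(0)^+ m),
    where R = (C(0) + gamma)^-1 and R_n = (C_n(0) + gamma)^-1. Reproduction gives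
    |phi x|^2 = k x x <= c, so that |m| <= sqrt c and all four covariance
    operators are bounded by c. The lag-zero operators are moreover positive,
    so that adding gamma makes them coercive: the resolvents are bounded by
    1 / gamma, and R_n m - R m is controlled by (C_n(0) - C(0)) (R m). The
    estimate is [regularized_estimate_error_le], and it holds pointwise in the
    random parameter.

    Two ingredients need work. Coercivity makes A + gamma injective with a
    bounded inverse; surjectivity comes from a contraction ([shift_surj]), which
    makes the functional inverse a genuine resolvent. The properties of C(eta)
    and of the mean embedding are read off their definition as Bochner
    integrals through scalar functionals ([bochner_integral_scalar]): a linear
    functional dominated by the norm commutes with the integral, and testing
    with h |-> <A h, g> yields bounds and positivity of an operator. When the
    integral does not exist its value is 0 by convention, which satisfies the
    same bounds. *)

(** * Bochner integrals tested against scalar functionals *)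

Section bochner_functional.
Context (R : realType) d (T : measurableType d).
Variables (mu : {measure set T -> \bar R}) (V : lmodType R) (N : V -> \bar R).

Lemma bochner_integralP (f : T -> V) :
  bochner_integral mu N f = 0 \/
  is_bochner_integral mu N f (bochner_integral mu N f).
Proof. by rewrite /bochner_integral; case: xgetP => [v _|]; [right|left]. Qed.

(** The integral of a nonnegative function is a supremum over the simple
    functions below it, hence monotone without measurability. This matters for
    [t |-> N (f t - s t)], whose measurability the definition of the Bochner
    integral does not include. *)
Lemma ge0_le_integralT_nonmeasurable (f g : T -> \bar R) :
  (forall t, 0 <= f t)%E -> (forall t, f t <= g t)%E ->
  (\int[mu]_t f t <= \int[mu]_t g t)%E.
Proof.
move=> f0 fg; have g0 t : (0 <= g t)%E by exact: le_trans (fg t).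
rewrite !ge0_integralTE//; apply: ereal_sup_le => _ [h hf <-].
by exists h => // t; exact: le_trans (fg t).
Qed.

Lemma bochner_simple_scalar (L : {scalar V}) (s : T -> V) :
  bochner_simple mu N s ->
  mu.-integrable [set: T] (EFin \o (L \o s)) /\
  (\int[mu]_t (L (s t))%:E = (L (bochner_simple_integral mu s))%:E)%E.
Proof.
move=> [sfin smeas sfinm _].
pose F v t := (L v * \1_(s @^-1` [set v]) t)%:E.
have intI v : v != 0 ->
    mu.-integrable [set: T] (fun t => (\1_(s @^-1` [set v]) t)%:E).
  move=> v0; apply/integrableP; split.
    by apply/measurable_EFinP; exact: measurable_indic.
  under eq_integral do rewrite gee0_abs ?lee_fin//.
  by rewrite integral_indic// setIT; exact: sfinm.
have F0 : F 0 = cst 0%E by apply/funext => t; rewrite /F linear0 mul0r.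
have intF v : mu.-integrable [set: T] (F v).
  have [->|v0] := eqVneq v 0; first by rewrite F0; exact: integrable0.
  have -> : F v = (fun t => (L v)%:E * (\1_(s @^-1` [set v]) t)%:E)%E.
    by apply/funext => t; rewrite /F EFinM.
  by apply: integrableZl => //; exact: intI.
have LE t : (L (s t))%:E = (\sum_(v <- finmap.enum_fset (fset_set (range s))) F v t)%E.
  rewrite sumEFin; congr EFin.
  rewrite (bigD1_seq (s t)) ?finmap.fset_uniq//=; last first.
    by rewrite in_fset_set// mem_set.
  rewrite indicE mem_set// mulr1 big1 ?addr0// => v vst.
  rewrite indicE memNset ?mulr0//= => /esym E; move: vst.
  by rewrite E eqxx.
split.
  have -> : EFin \o (L \o s) =
      (fun t => \sum_(v <- finmap.enum_fset (fset_set (range s))) F v t)%E.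
    by apply/funext => t; rewrite -LE.
  by apply: integrable_sum => // v _; exact: intF.
under eq_integral do rewrite LE.
rewrite integral_sum//= /bochner_simple_integral fsbig_finite//= linear_sum -sumEFin.
apply: eq_bigr => v _; rewrite linearZ /=.
(* The fibre over 0 may have infinite measure, but [L] vanishes there. *)
have [->|v0] := eqVneq v 0.
  by rewrite F0 integral_cst// mul0e linear0 mulr0.
rewrite /F; under eq_integral do rewrite EFinM.
rewrite integralZl//; last exact: intI.
rewrite integral_indic// setIT mulrC EFinM fineK// ge0_fin_numE ?measure_ge0//.
exact: sfinm.
Qed.

(** On simple functions [L] and the integral commute; passing to the limit, the
    error at step [n] is at most
    [\int N (f - s n) + N (v - bochner_simple_integral (s n))]. *)
Lemma bochner_integral_scalar1 (L : {scalar V}) (f : T -> V) (v : V) :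
  (forall u, `|L u|%:E <= N u)%E ->
  mu.-integrable [set: T] (EFin \o (L \o f)) ->
  is_bochner_integral mu N f v ->
  (\int[mu]_t (L (f t))%:E = (L v)%:E)%E.
Proof.
move=> LN Lf [s [ss _ sint sv]].
have fin : (\int[mu]_t (L (f t))%:E)%E \is a fin_num by exact: integrable_fin_num.
suff : (`|\int[mu]_t (L (f t))%:E - (L v)%:E| <= 0)%E.
  rewrite -(fineK fin) -EFinB abse_EFin lee_fin normr_le0 subr_eq0 => /eqP ->//.
have cv : (\int[mu]_t N (f t - s n t) + N (v - bochner_simple_integral mu (s n)))%E
    @[n --> \oo] --> 0%E.
  by rewrite -[X in _ --> X]adde0; apply: cvgeD.
apply: (cvge_to_ge cv); near=> n.
have [Ls intLs] := bochner_simple_scalar L (ss n).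
have -> : (\int[mu]_t (L (f t))%:E - (L v)%:E =
   \int[mu]_t (L (f t - s n t))%:E - (L (v - bochner_simple_integral mu (s n)))%:E)%E.
  under [in RHS]eq_integral do rewrite linearB EFinB.
  rewrite integralB_EFin// intLs -(fineK fin) linearB -!EFinB; congr EFin.
  by rewrite opprB addrA subrK.
have LfsE : (EFin \o (L \o (fun t => f t - s n t)%R) =
     (EFin \o (L \o f)) \- (EFin \o (L \o s n)))%E.
  by apply/funext => t /=; rewrite linearB EFinB.
apply: (le_trans (lee_abs_sub _ _)).
apply: leeD; last exact: LN.
have Lfs : mu.-integrable [set: T] (EFin \o (L \o (fun t => f t - s n t)%R)).
  by rewrite LfsE; exact: integrableB.
apply: le_trans (le_abse_integral _ _ _) _ => //; first by case/integrableP : Lfs.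
by apply: ge0_le_integralT_nonmeasurable => t; rewrite ?abse_ge0//= LN.
Unshelve. all: end_near. Qed.

(** Domination up to a constant reduces to the previous case by rescaling [L]. *)
Lemma bochner_integral_scalar (K : R) (L : {scalar V}) (f : T -> V) (v : V) :
  0 < K -> (forall u, `|L u|%:E <= K%:E * N u)%E ->
  mu.-integrable [set: T] (EFin \o (L \o f)) ->
  is_bochner_integral mu N f v ->
  (\int[mu]_t (L (f t))%:E = (L v)%:E)%E.
Proof.
move=> K0 LN Lf fv.
pose L1 u := K^-1 * L u.
have linL1 : linear_for *%R L1.
  by move=> a x y; rewrite /L1 linearP /= mulrDr mulrCA.
pose L' : {scalar V} := HB.pack L1 (GRing.isLinear.Build _ _ _ _ L1 linL1).
have L1f : mu.-integrable [set: T] (EFin \o (L' \o f)).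
  have -> : EFin \o (L' \o f) = (fun t => K^-1%:E * (EFin \o (L \o f)) t)%E.
    by apply/funext => t /=; rewrite -EFinM.
  exact: integrableZl.
have : (forall u, `|L' u|%:E <= N u)%E.
  move=> u; rewrite /= normrM gtr0_norm ?invr_gt0// EFinM lee_pdivrMl//.
move/bochner_integral_scalar1 => /(_ _ _ L1f fv) /=.
under eq_integral do rewrite EFinM.
rewrite integralZl// EFinM => /(congr1 (mule K%:E)).
by rewrite !muleA -EFinM divff ?gt_eqF// !mul1e.
Qed.
End bochner_functional.

(** * Operator norm *)

Section operator_norm.
Context (R : realType) (H : normedModType R).
Implicit Types A : H -> H.

(** The value [+oo] off the bounded linear operators makes the norm itself
    certify linearity. *)
Lemma opnormE_lty A : (opnormE A < +oo)%E -> linear A.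
Proof. by move=> /ereal_inf_lt[_ [M [linA _ _] _] _]. Qed.

Lemma ler_opnorm A (M : R) : linear A -> (forall h, `|A h| <= M * `|h|) ->
  forall h, `|A h| <= opnorm A * `|h|.
Proof.
move=> linA AM h.
pose S := [set B%:E | B in
    [set B : R | [/\ linear A, 0 <= B & forall h, `|A h| <= B * `|h|]]].
have SM : S (Num.max 0 M)%:E.
  exists (Num.max 0 M) => //; split => //; first by rewrite le_max lexx.
  by move=> g; rewrite (le_trans (AM g))// ler_wpM2r// le_max lexx orbT.
have S0 : (0 <= opnormE A)%E by apply/ereal_infP => _ [B [_ B0 _] <-].
have Sfin : opnormE A \is a fin_num.
  rewrite ge0_fin_numE//; apply: (@le_lt_trans _ _ (Num.max 0 M)%:E).
    exact: ereal_inf_lbound.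
  exact: ltry.
have [->|h0] := eqVneq h 0.
  rewrite normr0 mulr0.
  by have := AM 0; rewrite normr0 mulr0.
rewrite -ler_pdivrMr ?normr_gt0// -lee_fin /opnorm fineK//.
apply/ereal_infP => _ [B [_ B0 AB] <-].
by rewrite lee_fin ler_pdivrMr ?normr_gt0.
Qed.

End operator_norm.

(** * Coercive operators and resolvents in a Hilbert space *)

Section hilbert.
Context (R : realType) (H : completeNormedModType R) (ip : {dot H for idfun}).
Hypothesis ipE : forall h, `|h| ^+ 2 = ip h h.
Implicit Types (u v h : H) (A : H -> H).

Lemma ipC u v : ip u v = ip v u.
Proof. by rewrite (@hermC _ false idfun _ ip) mul1r. Qed.

Lemma ipZl a u v : ip (a *: u) v = a * ip u v.
Proof. exact: linearZl_LR. Qed.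

Lemma ipZr a u v : ip u (a *: v) = a * ip u v.
Proof. by rewrite ipC ipZl ipC. Qed.

Lemma ipBl u v w : ip (u - v) w = ip u w - ip v w.
Proof. exact: linearBl. Qed.

Lemma ipBr u v w : ip w (u - v) = ip w u - ip w v.
Proof. exact: linearBr. Qed.

Lemma ipDl u v w : ip (u + v) w = ip u w + ip v w.
Proof. exact: linearDl. Qed.

Lemma cauchy_schwarz u v : `|ip u v| <= `|u| * `|v|.
Proof.
have [->|v0] := eqVneq v 0; first by rewrite linear0r !normr0 mulr0.
have vv : 0 < ip v v by rewrite -ipE exprn_gt0// normr_gt0.
(* Up to the factor [ip v v], the component of [u] orthogonal to [v]. *)
have : 0 <= ip (ip v v *: u - ip u v *: v) (ip v v *: u - ip u v *: v).
  by rewrite -ipE sqr_ge0.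
rewrite !ipBl !ipBr !ipZl !ipZr /= (ipC v u).
set a := ip v v; set b := ip u v; set e := ip u u => ge0.
have : 0 <= a * (e * a - b ^+ 2).
  move: ge0; congr (_ <= _). ring.
rewrite pmulr_rge0// subr_ge0 /e /a -!ipE -exprMn -(real_normK (num_real b)).
by rewrite ler_sqr ?nnegrE ?mulr_ge0.
Qed.

(** The witness is [g := v / |v|]. *)
Lemma ler_norm_ip v (B : R) :
  (forall g, `|g| <= 1 -> ip v g <= B) -> `|v| <= B.
Proof.
move=> vB; have [->|v0] := eqVneq v 0.
  by rewrite normr0; have := vB 0; rewrite normr0 linear0r; apply.
have := vB (`|v|^-1 *: v); rewrite normrZ normfV normr_id mulVf ?normr_eq0//.
rewrite ipZr -ipE expr2 mulKf ?normr_eq0//; exact.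
Qed.

Lemma linear_opB A u v : linear A -> A (u - v) = A u - A v.
Proof.
by move=> linA; rewrite addrC -scaleN1r linA scaleN1r addrC.
Qed.

Variable g : R.
Hypothesis g0 : 0 < g.

(** Positivity gives [g * |h|^2 <= ip (A h + g *: h) h], and Cauchy-Schwarz
    bounds the right-hand side. *)
Lemma shift_coercive A : (forall h, 0 <= ip (A h) h) ->
  forall h, g * `|h| <= `|A h + g *: h|.
Proof.
move=> A0 h; have [->|h0] := eqVneq h 0; first by rewrite normr0 mulr0.
rewrite -(@ler_pM2r _ `|h|) ?normr_gt0//.
apply: le_trans (le_trans (ler_norm _) (cauchy_schwarz _ _)).
by rewrite ipDl ipZl -mulrA -expr2 ipE lerDr.
Qed.

(** The Lax-Milgram argument: for [B := A + g] bounded by [K] and coercive with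
    constant [g], a solution of [B x = y] is a fixed point of
    [h |-> h - s *: (B h - y)]. Expanding the square,
    [|w - s *: B w|^2 <= (1 - 2 * s * g + s^2 * K^2) * |w|^2], and [s := g / K^2]
    minimizes this factor, with value [1 - (g / K)^2]. *)
Lemma shift_surj A (M : R) : linear A -> (forall h, `|A h| <= M * `|h|) ->
  (forall h, 0 <= ip (A h) h) -> forall y, exists x, A x + g *: x = y.
Proof.
move=> linA AM A0 y.
pose B h := A h + g *: h.
pose K := `|M| + g.
have K0 : 0 < K by rewrite ltr_wpDl.
have BK h : `|B h| <= K * `|h|.
  rewrite (le_trans (ler_normD _ _))// mulrDl lerD// ?normrZ ?(gtr0_norm g0)//.
  by rewrite (le_trans (AM h))// ler_wpM2r// ler_norm.
have linB u v : B (u - v) = B u - B v.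
  by rewrite /B linear_opB// scalerBr opprD addrACA.
pose s := g / K ^+ 2.
have gK : g <= K by rewrite lerDr.
pose q2 := 1 - (g / K) ^+ 2.
have q20 : 0 <= q2.
  have gK0 : 0 <= g / K by rewrite divr_ge0// ltW.
  by rewrite subr_ge0 exprn_ile1// ler_pdivrMr// mul1r.
have q21 : q2 < 1 by rewrite ltrBlDr ltrDl exprn_gt0// divr_gt0.
pose f h := h - s *: (B h - y).
have fctr u v : `|f u - f v| <= Num.sqrt q2 * `|u - v|.
  have -> : f u - f v = (u - v) - s *: B (u - v).
    rewrite /f linB opprD opprK addrACA; congr (_ + _).
    by rewrite addrC -opprB -scalerBr opprB addrA subrK.
  rewrite -ler_sqr ?nnegrE ?mulr_ge0 ?sqrtr_ge0// exprMn sqr_sqrtr//.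
  move: (u - v) => w.
  rewrite ipE !ipBl !ipBr !ipZl !ipZr /= (ipC w (B w)) -!ipE.
  have Bw : g * `|w| ^+ 2 <= ip (B w) w.
    by rewrite ipDl ipZl -ipE lerDr.
  have Bw2 : `|B w| ^+ 2 <= K ^+ 2 * `|w| ^+ 2.
    by rewrite -exprMn ler_sqr ?nnegrE// mulr_ge0// ltW.
  have -> : `|w| ^+ 2 - s * ip (B w) w - (s * ip (B w) w - s * (s * `|B w| ^+ 2)) =
    `|w| ^+ 2 - 2 * s * ip (B w) w + s ^+ 2 * `|B w| ^+ 2 by ring.
  have s0 : 0 <= s by rewrite divr_ge0 ?exprn_ge0// ltW.
  have sBw := ler_wpM2l s0 Bw.
  have s2Bw := ler_wpM2l (sqr_ge0 s) Bw2.
  have sE : s * g = (g / K) ^+ 2 by rewrite /s; field; rewrite gt_eqF.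
  have sE2 : s ^+ 2 * K ^+ 2 = (g / K) ^+ 2 by rewrite /s; field; rewrite gt_eqF.
  rewrite mulrA sE in sBw; rewrite [leRHS]mulrA sE2 in s2Bw.
  rewrite /q2; lra.
have fT : set_fun [set: H] [set: H] f by [].
pose F : {fun [set: H] >-> [set: H]} :=
  HB.pack f (isFun.Build H H [set: H] [set: H] f fT).
have Fc : is_contraction F.
  exists (NngNum (sqrtr_ge0 q2)); split.
    by rewrite /= -[ltRHS]sqrtr1 ltr_sqrt.
  by move=> [u v] _ /=; exact: fctr.
have [x _ xE] := banach_fixed_point Fc closedT (ex_intro _ 0 I).
exists x; apply/eqP; rewrite -subr_eq0 -/(B x).
move/eqP: xE; rewrite /= /f -subr_eq0 opprB addrC subrK scaler_eq0.
by rewrite mulf_eq0 invr_eq0 expf_eq0 !gt_eqF//.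
Qed.

Section resolvent.
Variables (A : H -> H) (M : R).
Hypothesis linA : linear A.
Hypothesis AM : forall h, `|A h| <= M * `|h|.
Hypothesis A0 : forall h, 0 <= ip (A h) h.

Lemma regularized_inverseK y :
  A (regularized_inverse A g y) + g *: regularized_inverse A g y = y.
Proof.
apply: (@pinvK _ _ (fun=> 0) [set: H] (fun h => A h + g *: h) y).
by rewrite inE /=; have [x <-] := shift_surj linA AM A0 y; exists x.
Qed.

Lemma regularized_inverseB_le y y' :
  `|regularized_inverse A g y - regularized_inverse A g y'| <= g^-1 * `|y - y'|.
Proof.
rewrite ler_pdivlMl//; apply: (le_trans (shift_coercive A0 _)).
rewrite linear_opB// scalerBr addrACA -opprD.
by rewrite !regularized_inverseK.
Qed.

Lemma regularized_inverse_le y : `|regularized_inverse A g y| <= g^-1 * `|y|.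
Proof.
rewrite ler_pdivlMl//; apply: (le_trans (shift_coercive A0 _)).
by rewrite regularized_inverseK.
Qed.
End resolvent.

(** Resolvent identity, in the form needed for norms: with [x] and [x'] the two
    solutions, [(A + g) (x - x') = (A' - A) x'], to which coercivity applies. *)
Lemma resolvent_le A A' M M' y :
  linear A -> (forall h, `|A h| <= M * `|h|) -> (forall h, 0 <= ip (A h) h) ->
  linear A' -> (forall h, `|A' h| <= M' * `|h|) -> (forall h, 0 <= ip (A' h) h) ->
  `|regularized_inverse A g y - regularized_inverse A' g y| <=
  g^-1 * `|(A - A') (regularized_inverse A' g y)|.
Proof.
move=> lA AM A0 lA' AM' A0'.
rewrite ler_pdivlMl//; apply: (le_trans (shift_coercive A0 _)).
rewrite linear_opB// scalerBr addrACA -opprD.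
rewrite (regularized_inverseK lA AM A0).
have := regularized_inverseK lA' AM' A0' y.
set x := regularized_inverse A' g y => xE.
by rewrite -[in leLHS]xE opprD addrACA subrr addr0 -normrN opprB.
Qed.

End hilbert.

Lemma integral_bounded (R : realType) d (T : measurableType d)
    (mu : {measure set T -> \bar R}) (f : T -> R) (B : R) :
  (mu [set: T] <= 1)%E -> measurable_fun [set: T] f ->
  (forall t, `|f t| <= B) -> 0 <= B ->
  mu.-integrable [set: T] (EFin \o f) /\ (\int[mu]_t (f t)%:E <= B%:E)%E.
Proof.
move=> mu1 mf fB B0.
have mEf : measurable_fun [set: T] (EFin \o f) by exact/measurable_EFinP.
have fle : (\int[mu]_t `|(EFin \o f) t| <= B%:E)%E.
  have := @integral_le_bound _ _ _ mu setT (EFin \o f) B%:E measurableT mEf.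
  rewrite lee_fin => /(_ B0 _)/le_trans; apply.
    by apply: aeW => t _; rewrite lee_fin.
  by rewrite -[leRHS]mule1 lee_wpmul2l.
split; first by apply/integrableP; split => //; exact: le_lt_trans (ltry B).
apply: le_trans fle; apply: le_trans (le_abse_integral _ _ _) => //.
exact: lee_abs.
Qed.

(** * Hilbert-space and operator-valued Bochner integrals *)

Section bochner_hilbert.
Context (R : realType) (H : completeNormedModType R) (ip : {dot H for idfun}).
Hypothesis ipE : forall h, `|h| ^+ 2 = ip h h.

Lemma ip_continuous g : continuous (fun h => ip h g).
Proof.
move=> h; apply/cvgrPdist_lt => e e0; near=> y.
rewrite -ipBl; apply: le_lt_trans (cauchy_schwarz ipE _ _) _.
apply: (@le_lt_trans _ _ (`|h - y| * (`|g| + 1))).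
  by rewrite ler_wpM2l// lerDl.
rewrite -ltr_pdivlMr ?ltr_wpDl//.
by near: y; apply: cvgr_dist_lt => //; rewrite divr_gt0// ltr_wpDl.
Unshelve. all: end_near. Qed.

Lemma measurable_ip g :
  measurable_fun [set: borel H] ((fun h => ip h g) : borel H -> R).
Proof.
apply: (measurability _ (RGenOpens.measurableE R)) => _ [_ [a [b ->] <-]].
rewrite setTI; apply: sub_sigma_algebra.
by have /continuousP := @ip_continuous g; apply; exact: interval_open.
Qed.

Lemma bochner_mean_norm_le d (T : measurableType d)
    (mu : {measure set T -> \bar R}) (f : T -> H) (B : R) :
  (mu [set: T] <= 1)%E ->
  measurable_fun [set: T] (f : T -> borel H) ->
  (forall t, `|f t| <= B) -> 0 <= B ->
  `|bochner_integral mu (@normE R H) f| <= B.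
Proof.
move=> mu1 mf fB B0.
have [->|fI] := bochner_integralP mu (@normE R H) f; first by rewrite normr0.
apply: (ler_norm_ip ipE) => g g1.
have linL : linear_for *%R (fun h => ip h g).
  by move=> a x y; rewrite ipDl ipZl.
pose L : {scalar H} :=
  HB.pack (fun h => ip h g) (GRing.isLinear.Build _ _ _ _ (fun h => ip h g) linL).
have Lle h : `|ip h g| <= `|h|.
  by rewrite (le_trans (cauchy_schwarz ipE _ _))// ler_piMr.
have [Li Lb] := integral_bounded mu1
  (measurableT_comp (measurable_ip g) mf : measurable_fun _ (fun t => ip (f t) g))
  (fun t => le_trans (Lle (f t)) (fB t)) B0.
have Ldom u : (`|L u|%:E <= 1%:E * normE u)%E by rewrite mul1e lee_fin Lle.
by rewrite -lee_fin -(bochner_integral_scalar ltr01 Ldom Li fI).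
Qed.

Section operator_valued.
Context d (T : measurableType d) (mu : {measure set T -> \bar R}).
Variables (F : T -> H -> H) (K : R).
Hypothesis mu1 : (mu [set: T] <= 1)%E.
Hypothesis mF : forall h g, measurable_fun [set: T] (fun t => ip (F t h) g).
Hypothesis FK : forall t h, `|F t h| <= K * `|h|.
Hypothesis K0 : 0 <= K.
Let V := bochner_integral mu (@opnormE R H) F.

Lemma bochner_simple_integral_linear (s : T -> H -> H) :
  bochner_simple mu (@opnormE R H) s -> linear (bochner_simple_integral mu s).
Proof.
move=> [sfin _ _ sfinN]; rewrite /bochner_simple_integral fsbig_finite//=.
rewrite big_seq; apply: big_ind => [a u v|A B linA linB a u v|v].
- by change (0 = a *: (0 : H) + 0); rewrite scaler0 addr0.
- change (A (a *: u + v) + B (a *: u + v) = a *: (A u + B u) + (A v + B v)).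
  by rewrite linA linB scalerDr addrACA.
rewrite in_fset_set// inE => -[t _ <-] a x y.
set p := fine _; change (p *: s t (a *: x + y) = a *: (p *: s t x) + p *: s t y).
by rewrite (opnormE_lty (sfinN t)) scalerDr !scalerA mulrC.
Qed.

(** A simple approximation at finite [opnormE]
    distance is linear, and so is its difference with the integral. *)
Lemma bochner_operator_linear : linear V.
Proof.
rewrite /V; case: (bochner_integralP mu (@opnormE R H) F) => [->|].
  by move=> a u v; change (0 = a *: (0 : H) + 0); rewrite scaler0 addr0.
set W : H -> H := bochner_integral _ _ _ =>
  -[s [ss _ _ /fine_cvgP[[n _ /(_ n) fin] _]]] a u v.
have {fin} : (opnormE (W - bochner_simple_integral mu (s n))%R < +oo)%E.
  move: fin => /= /(_ (leqnn n)); rewrite fin_numE => /andP[_].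
  by rewrite lt_neqAle leey andbT.
set S : H -> H := bochner_simple_integral mu (s n).
move=> /opnormE_lty /(_ a u v).
change (W (a *: u + v) - S (a *: u + v) = a *: (W u - S u) + (W v - S v) ->
  W (a *: u + v) = a *: W u + W v).
have linS : linear S := bochner_simple_integral_linear (ss n).
rewrite linS scalerBr opprD addrACA => /addIr.
exact.
Qed.

(** The functional [A |-> ip (A h) g] is dominated by [|h| * |g|] times the
    operator norm; the constant used is increased to be positive. *)
Lemma bochner_operator_ip h g : V = 0 \/
  (\int[mu]_t (ip (F t h) g)%:E = (ip (V h) g)%:E)%E.
Proof.
rewrite /V; case: (bochner_integralP mu (@opnormE R H) F) => [->|FI]; first by left.
right.
have linL : linear_for *%R (fun A : H -> H => ip (A h) g).
  move=> a A B; change (ip (a *: A h + B h) g = a * ip (A h) g + ip (B h) g).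
  by rewrite ipDl ipZl.
pose L : {scalar (H -> H)} :=
  HB.pack (fun A : H -> H => ip (A h) g)
    (GRing.isLinear.Build _ _ _ _ (fun A : H -> H => ip (A h) g) linL).
pose k := (`|h| + 1) * (`|g| + 1).
have k0 : 0 < k by rewrite mulr_gt0 ?ltr_wpDl.
apply: (@bochner_integral_scalar _ _ _ mu _ _ k L F _ k0 _ _ FI) => [A|].
  rewrite -lee_pdivrMl//; apply/ereal_infP => _ [B [_ B0 AB] <-].
  rewrite -EFinM lee_fin ler_pdivrMl//.
  apply: (le_trans (cauchy_schwarz ipE _ _)).
  apply: (@le_trans _ _ (B * `|h| * `|g|)); first by rewrite ler_wpM2r.
  rewrite -mulrA mulrC ler_wpM2r// ler_pM// lerDl//.
have [] // :=
  @integral_bounded _ _ _ mu (fun t => ip (F t h) g) (K * `|h| * `|g|) mu1 (mF h g).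
  move=> t; rewrite (le_trans (cauchy_schwarz ipE _ _))// ler_wpM2r//.
by rewrite !mulr_ge0.
Qed.

Lemma bochner_operator_le h : `|V h| <= K * `|h|.
Proof.
apply: (ler_norm_ip ipE) => g g1.
have [->|E] := bochner_operator_ip h g.
  by rewrite linear0l mulr_ge0.
rewrite -lee_fin -E.
have [] // :=
  @integral_bounded _ _ _ mu (fun t => ip (F t h) g) (K * `|h|) mu1 (mF h g).
  move=> t; rewrite (le_trans (cauchy_schwarz ipE _ _))//.
  by apply: le_trans (FK t h); rewrite ler_piMr.
by rewrite mulr_ge0.
Qed.

Lemma bochner_operator_ge0 :
  (forall t h, 0 <= ip (F t h) h) -> forall h, 0 <= ip (V h) h.
Proof.
move=> F0 h; have [->|E] := bochner_operator_ip h h; first by rewrite linear0l.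
by rewrite -lee_fin -E; apply: integral_ge0 => t _; rewrite lee_fin.
Qed.

End operator_valued.
End bochner_hilbert.

(** * Autocovariance operators of a bounded process *)

Section autocovariance_facts.
Context (R : realType) (H : completeNormedModType R) (ip : {dot H for idfun}).
Hypothesis ipE : forall h, `|h| ^+ 2 = ip h h.

Lemma rank_one_linear (u v : H) : linear (rank_one ip u v).
Proof. by move=> a x y; rewrite /rank_one ipDl ipZl scalerDl scalerA. Qed.

Lemma rank_one_le (c b : R) (u v h : H) :
  b ^+ 2 = c -> `|u| <= b -> `|v| <= b -> `|rank_one ip u v h| <= c * `|h|.
Proof.
move=> <- ub vb; rewrite /rank_one normrZ expr2 mulrAC.
apply: ler_pM => //; rewrite mulrC.
by apply: (le_trans (cauchy_schwarz ipE _ _)); rewrite ler_wpM2l.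
Qed.

Lemma rank_one_ge0 (u h : H) : 0 <= ip (rank_one ip u u h) h.
Proof. by rewrite /rank_one ipZl (ipC _ u) -expr2 sqr_ge0. Qed.

Context d (T : measurableType d) (P : probability T R).
Variables (Y : int -> T -> H) (b c : R).
Hypothesis bc : b ^+ 2 = c.
Hypothesis Yb : forall t w, `|Y t w| <= b.
Hypothesis mY : forall t, measurable_fun [set: T] (Y t : T -> borel H).

Let c0 : 0 <= c. Proof. by rewrite -bc sqr_ge0. Qed.

Let measurable_rank_one eta h g :
  measurable_fun [set: T]
    (fun w => ip (rank_one ip (Y eta%:Z w) (Y 0 w) h) g).
Proof.
have -> : (fun w => ip (rank_one ip (Y eta%:Z w) (Y 0 w) h) g) =
    ((fun w => ip (Y 0 w) h) \* (fun w => ip (Y eta%:Z w) g))%R.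
  by apply/funext => w; rewrite /rank_one ipZl (ipC _ h).
by apply: measurable_funM; exact: (measurableT_comp (measurable_ip ipE _) (mY _)).
Qed.

Let rank_oneY eta w h : `|rank_one ip (Y eta%:Z w) (Y 0 w) h| <= c * `|h|.
Proof. exact: (rank_one_le _ bc). Qed.

Let P1 : (P [set: T] <= 1)%E.
Proof. by rewrite probability_setT. Qed.

Lemma autocov_linear eta : linear (autocov P ip Y eta).
Proof. exact: bochner_operator_linear. Qed.

Lemma autocov_le eta h : `|autocov P ip Y eta h| <= c * `|h|.
Proof. exact: bochner_operator_le. Qed.

Lemma autocov0_ge0 h : 0 <= ip (autocov P ip Y 0 h) h.
Proof.
apply: (bochner_operator_ge0 ipE (K := c)) => // w g; exact: rank_one_ge0.
Qed.

Lemma emp_autocovE n eta w h : emp_autocov ip Y n eta w h =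
  n%:R^-1 *: \sum_(1 <= t < n.+1) rank_one ip (Y (t%:Z + eta%:Z) w) (Y t%:Z w) h.
Proof.
rewrite /emp_autocov.
by change (n%:R^-1 *: ((\sum_(1 <= t < n.+1)
  rank_one ip (Y (t%:Z + eta%:Z) w) (Y t%:Z w)) h) = n%:R^-1 *: \sum_(1 <= t < n.+1)
  rank_one ip (Y (t%:Z + eta%:Z) w) (Y t%:Z w) h); rewrite fct_sumE.
Qed.

Lemma emp_autocov_linear n eta w : linear (emp_autocov ip Y n eta w).
Proof.
move=> a x y; rewrite !emp_autocovE scalerA mulrC -scalerA -scalerDr.
congr (_ *: _); rewrite scaler_sumr -big_split.
by apply: eq_bigr => t _; rewrite rank_one_linear.
Qed.

Lemma emp_autocov_le n eta w h : (0 < n)%N ->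
  `|emp_autocov ip Y n eta w h| <= c * `|h|.
Proof.
move=> n0; rewrite emp_autocovE normrZ gtr0_norm ?invr_gt0 ?ltr0n//.
rewrite ler_pdivrMl ?ltr0n// (le_trans (ler_norm_sum _ _ _))//.
rewrite (le_trans (ler_sum _ (fun t _ => rank_one_le h bc (Yb _ w) (Yb _ w))))//.
by rewrite sumr_const_nat subn1 /= mulr_natl.
Qed.

Lemma emp_autocov0_ge0 n w h : 0 <= ip (emp_autocov ip Y n 0 w h) h.
Proof.
rewrite emp_autocovE ipZl mulr_ge0 ?invr_ge0//.
rewrite linear_sumlz sumr_ge0// => t _; rewrite addr0.
exact: rank_one_ge0.
Qed.
End autocovariance_facts.

(** * Error decomposition *)

Section error.
Context (R : realType) (H : completeNormedModType R) (ip : {dot H for idfun}).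
Hypothesis ipE : forall h, `|h| ^+ 2 = ip h h.

(** Everything is deterministic here: [A], [An], [B], [Bn] stand for the
    population and empirical covariance operators at lag zero and at the given
    lag, and [x] for [C(0)^+ m]. The constants are one factor [c] per outer
    operator, one [g^-1] per resolvent, and [b] for [m]. *)
Lemma regularized_estimate_error_le (A An B Bn : H -> H) (b c g : R) (m mhat x : H) :
  0 < g ->
  linear A -> linear An -> linear B -> linear Bn ->
  (forall h, `|A h| <= c * `|h|) -> (forall h, `|An h| <= c * `|h|) ->
  (forall h, `|B h| <= c * `|h|) -> (forall h, `|Bn h| <= c * `|h|) ->
  (forall h, 0 <= ip (A h) h) -> (forall h, 0 <= ip (An h) h) ->
  `|m| <= b -> 0 <= c ->
  `|Bn (regularized_inverse An g mhat) - B x| <=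
    c / g * `|mhat - m| + c * b / g ^+ 2 * opnorm (An - A)
    + b / g * opnorm (Bn - B) + c * `|regularized_inverse A g m - x|.
Proof.
move=> g0 lA lAn lB lBn Ac Anc Bc Bnc A0 An0 mb c0.
set Rn := regularized_inverse An g; set R0 := regularized_inverse A g.
have linD (S S' : H -> H) : linear S -> linear S' -> linear (S - S').
  move=> lS lS' a u v.
  change (S (a *: u + v) - S' (a *: u + v) = a *: (S u - S' u) + (S v - S' v)).
  by rewrite lS lS' scalerBr opprD addrACA.
have boundD (S S' : H -> H) : (forall h, `|S h| <= c * `|h|) ->
    (forall h, `|S' h| <= c * `|h|) -> forall h, `|(S - S') h| <= (c + c) * `|h|.
  move=> Sc S'c h; change (`|S h - S' h| <= (c + c) * `|h|).
  by rewrite (le_trans (ler_normB _ _))// mulrDl lerD.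
have dA := ler_opnorm (linD _ _ lAn lA) (boundD _ _ Anc Ac).
have dB := ler_opnorm (linD _ _ lBn lB) (boundD _ _ Bnc Bc).
have opnorm_ge0 (S : H -> H) : 0 <= opnorm S.
  by apply: fine_ge0; apply/ereal_infP => _ [D [_ D0 _] <-].
have R0m : `|R0 m| <= b / g.
  rewrite mulrC (le_trans (regularized_inverse_le ipE g0 lA Ac A0 m))//.
  by rewrite ler_pM2l ?invr_gt0.
have -> : Bn (Rn mhat) - B x = Bn (Rn mhat - Rn m) + Bn (Rn m - R0 m)
    + (Bn - B) (R0 m) + B (R0 m - x).
  rewrite !(linear_opB _ _ lBn) (linear_opB _ _ lB).
  change (Bn (Rn mhat) - B x = Bn (Rn mhat) - Bn (Rn m) + (Bn (Rn m) - Bn (R0 m))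
    + (Bn (R0 m) - B (R0 m)) + (B (R0 m) - B x)).
  by rewrite !addrA !subrK.
have e1 : `|Bn (Rn mhat - Rn m)| <= c / g * `|mhat - m|.
  apply: (le_trans (Bnc _)); rewrite -mulrA ler_wpM2l//.
  exact: (regularized_inverseB_le ipE g0 lAn Anc An0).
have e2 : `|Bn (Rn m - R0 m)| <= c * b / g ^+ 2 * opnorm (An - A).
  apply: (le_trans (Bnc _)).
  have -> : c * b / g ^+ 2 * opnorm (An - A) =
      c * (g^-1 * (opnorm (An - A) * (b / g))).
    by field; rewrite gt_eqF.
  apply: ler_wpM2l => //.
  apply: le_trans (resolvent_le ipE g0 _ lAn Anc An0 lA Ac A0) _.
  rewrite ler_pM2l ?invr_gt0//; apply: le_trans (dA _) _.
  by rewrite ler_wpM2l.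
have e3 : `|(Bn - B) (R0 m)| <= b / g * opnorm (Bn - B).
  by apply: le_trans (dB _) _; rewrite mulrC ler_wpM2r.
have e4 := Bc (R0 m - x).
apply: le_trans (ler_normD _ _) _; apply: lerD e4.
apply: le_trans (ler_normD _ _) _; apply: lerD e3.
exact: le_trans (ler_normD _ _) (lerD e1 e2).
Qed.
End error.

Theorem theorem28 (R : realType)
  (d : measure_display) (T : measurableType d) (P : probability T R)
  (E : ptopologicalType) (X : int -> {RV P >-> borel E})
  (H : completeNormedModType R) (ip : {dot H for idfun})
  (ev : H -> E -> R) (k : E -> E -> R) (phi : E -> H)
  (z : {finite_measure set (borel E) -> \bar R})
  (muhat : T -> H) (condE : H -> E -> R)
  (c gamma : R) (n eta : nat)
  (Y := fun t w => phi (X t w))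
  (mu_z := bochner_integral z (@normE R H) phi)
  (C := autocov P ip Y) (Cn := emp_autocov ip Y n)
  (U := cond_mean_op P ip Y eta) (Un := emp_cond_mean_op ip Y gamma n eta) :
  polish R E ->
  stationary X ->
  is_rkhs ip ev k phi ->
  separable H ->
  measurable_fun [set: borel E] (phi : borel E -> borel H) ->
  (\int[P]_w (`|Y 0 w| ^+ 2)%:E < +oo)%E ->
  bochner_integral P (@normE R H) (Y 0) = 0 ->
  has_ubound (range (fun x => k x x)) ->
  sup (range (fun x => k x x)) = c ->
  0 < gamma -> (0 < n)%N -> (0 < eta)%N ->
  (z [set: borel E] <= 1)%E ->
  (\int[z]_x `|phi x|%:E < +oo)%E ->
  mu_z \in pseudoinverse_dom ip (C 0%N) ->
  (forall f t, is_cond_mean (X t) (fun w => ev f (X (t + eta%:Z) w))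
                 (condE f : borel E -> R)) ->
  (forall f, z.-integrable [set: borel E] (EFin \o condE f) /\
     ip f (U mu_z) = \int[z]_x condE f x) ->
  {ae P, forall w,
    `|Un w (muhat w) - U mu_z| <=
      (c / gamma * `|muhat w - mu_z|
       + c `^ (3 / 2) / gamma ^+ 2 * opnorm (Cn 0%N w - C 0%N)
       + c `^ (1 / 2) / gamma * opnorm (Cn eta w - C eta))
      + c * `|regularized_inverse (C 0%N) gamma mu_z
              - pseudoinverse ip (C 0%N) mu_z| }.
Proof.
move=> _ _ rk _ mphi _ _ kub kc g0 n0 _ z1 _ _ _ _.
have ipE := rkhs_norm rk.
have phi_sq x : `|phi x| ^+ 2 = k x x.
  by rewrite ipE -(rkhs_reproducing rk) (rkhs_feature rk).
have kle x : k x x <= c by rewrite -kc; apply: ub_le_sup => //; exists x.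
have c0 : 0 <= c by apply: le_trans (kle point); rewrite -phi_sq sqr_ge0.
pose b := Num.sqrt c.
have bc : b ^+ 2 = c by rewrite sqr_sqrtr.
have phib x : `|phi x| <= b.
  by rewrite -ler_sqr ?nnegrE ?sqrtr_ge0// bc phi_sq.
have mY t : measurable_fun [set: T] (Y t : T -> borel H).
  exact: measurableT_comp mphi (measurable_funPT (X t)).
have Yb t w : `|Y t w| <= b by exact: phib.
have mzb : `|mu_z| <= b.
  by apply: (bochner_mean_norm_le ipE) => //; rewrite sqrtr_ge0.
have cb : c `^ (1 / 2) = b by rewrite div1r powR12_sqrt.
have c3b : c `^ (3 / 2) = c * b.
  have -> : 3 / 2 = 1 + 1 / 2 :> R by field.
  rewrite powRD; first by rewrite cb powRr1.
  by apply/implyP; rewrite gt_eqF// addr_gt0// divr_gt0.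
apply: aeW => w; rewrite cb c3b.
apply: (regularized_estimate_error_le ipE (A := C 0%N) (An := Cn 0%N w) (B := C eta)
  (Bn := Cn eta w) (muhat w) (pseudoinverse ip (C 0%N) mu_z)
  g0 _ _ _ _ _ _ _ _ _ _ mzb c0).
- exact: autocov_linear.
- exact: emp_autocov_linear.
- exact: autocov_linear.
- exact: emp_autocov_linear.
- exact: (autocov_le ipE P bc Yb mY).
- by move=> h; exact: (emp_autocov_le ipE bc Yb).
- exact: (autocov_le ipE P bc Yb mY).
- by move=> h; exact: (emp_autocov_le ipE bc Yb).
- exact: (autocov0_ge0 ipE P bc Yb mY).
- exact: emp_autocov0_ge0.
Qed.
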